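(* Let $p$ be a prime, $u\ge0$ and $v\ge1$ integers. Then for every integer $n\ge0$, $$v_p(\#\operatorname{Hom}(C_{p^u},GL_n(\mathbb{F}_{p^v})))\geq v\,\frac{p^u-1}{p^u+1}\binom{n}{2},$$ and equality holds if $n\equiv 0$ or $1\pmod{p^u+1}$.
   Context: $C_m$ is the cyclic group of order $m$, $\mathbb{F}_{p^v}$ the field with $p^v$ elements, $\#\operatorname{Hom}(G,H)$ the number of group homomorphisms from $G$ to $H$, and $v_p$ the $p$-adic valuation. *)

(* Defs.v *)
From HB Require Import structures.
From mathcomp Require Import all_boot all_order all_fingroup all_algebra.
From mathcomp Require Import all_solvable.

Set Implicit Arguments.
Unset Strict Implicit.
Unset Printing Implicit Defensive.

Local Open Scope ring_scope.

(* MathComp's {'GL_n[F]} consists of matrices of size n.-1.+1, so its value at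
   n = 0 is GL_1.  The type below is the group of invertible n x n matrices for
   every n; in particular it is trivial for n = 0. *)
Section GeneralLinear.

Variables (n : nat) (F : finFieldType).

Record gl : predArgType := GL {gl_mx :> 'M[F]_n; gl_unit : gl_mx \in unitmx}.

HB.instance Definition _ := [isSub for gl_mx].
HB.instance Definition _ := [Finite of gl by <:].

Fact gl_one_subproof : (1%:M : 'M[F]_n) \in unitmx.
Proof. exact: unitmx1. Qed.

Fact gl_mul_subproof (A B : gl) : (A : 'M_n) *m B \in unitmx.
Proof. by rewrite unitmx_mul !gl_unit. Qed.

Fact gl_inv_subproof (A : gl) : invmx A \in unitmx.
Proof. by rewrite unitmx_inv gl_unit. Qed.

Definition gl_one : gl := GL gl_one_subproof.
Definition gl_mul (A B : gl) : gl := GL (gl_mul_subproof A B).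
Definition gl_inv (A : gl) : gl := GL (gl_inv_subproof A).

Fact gl_mulA : associative gl_mul.
Proof. by move=> A B C; apply: val_inj; rewrite /= mulmxA. Qed.

Fact gl_mul1 : left_id gl_one gl_mul.
Proof. by move=> A; apply: val_inj; rewrite /= mul1mx. Qed.

Fact gl_mulV : left_inverse gl_one gl_inv gl_mul.
Proof. by move=> A; apply: val_inj; rewrite /= mulVmx ?gl_unit. Qed.

HB.instance Definition _ := Finite_isGroup.Build gl gl_mulA gl_mul1 gl_mulV.

End GeneralLinear.

Definition group_homs (G H : finGroupType) : {set {ffun G -> H}} :=
  [set f : {ffun G -> H} | morphic [set: G] f].

(* Main.v *)
Require Import Defs.
From mathcomp Require Import all_boot all_order all_fingroup all_algebra.
From mathcomp Require Import all_solvable.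
From mathcomp Require Import finfield mxabelem zify.

(* Homomorphisms from C_(p^u) correspond to matrices A with A^P = 1, P = p^u,
   hence in characteristic p, via T = A - 1, to matrices T with T^P = 0.  Let
   d j n be the number of pairs (T, v) with T^P = 0 and v T^j = 0, T an n x n
   matrix and v a vector; thus d 0 n is the number wanted, and
   d P n = q^n d 0 n with q = p^v.  If the order of v is exactly j, then
   v, v T, ..., v T^(j-1) are independent; in a basis extending them T is block
   lower triangular, with a shift block and a block D such that D^P = 0, and
   counting the possible corners gives, for 1 <= j <= P,
     d j (j + m) - d (j-1) (j + m) = #(free j-tuples) q^((j-1)m) d (P-j) m.
   Summing over j expresses (q^n - 1) d 0 n, where q^n - 1 is prime to p, by
   values of d at smaller sizes, and by strong induction
     v_p(d j n) >= v ((P-1) binomial(n,2) + j n) / (P+1).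
   In each of these sums one term has the smallest bound; following that term
   shows that equality passes, for j = 0, from n to n + P + 1. *)

Set Implicit Arguments.
Unset Strict Implicit.
Unset Printing Implicit Defensive.

Import Order.TTheory GRing.Theory Num.Theory.

(** * Arithmetic of the lower bounds *)

Definition weight (P j n : nat) : nat := P.-1 * 'C(n, 2) + j * n.

(* The ceiling of [v * a / P.+1]. *)
Definition ceil_val (P v a : nat) : nat := (v * a + P) %/ P.+1.

Lemma bin2D (l m : nat) : 'C(l + m, 2) = 'C(l, 2) + 'C(m, 2) + l * m.
Proof.
elim: l => [|l IH]; first by rewrite bin0n add0n mul0n addn0.
by rewrite addSn !binS IH !bin1; lia.
Qed.

(** The last factor is the exponent of [q] gained when a chain of length [l.+1] is split off:
    ['C(l.+1, 2)] from the free tuples, [l * m] from the corners. As this is an equality, the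
    recursion loses nothing in the bound. *)
Lemma weight_step (P l m : nat) : l < P ->
  weight P l (l.+1 + m) =
  weight P (P - l.+1) m + P.+1 * ('C(l.+1, 2) + l * m).
Proof.
move=> lP; rewrite /weight bin2D.
have E : 'C(l.+1, 2) * 2 = l * l.+1 by rewrite mulnC -mul_bin_diag bin1 mulnC.
have {lP}[r ->] : exists r, P = l.+1 + r by exists (P - l.+1); rewrite subnKC.
rewrite addKn /= addSn /=.
move: 'C(l.+1, 2) 'C(m, 2) E => b c; nia.
Qed.

Lemma ceil_valD (P v a b : nat) :
  ceil_val P v (a + P.+1 * b) = ceil_val P v a + v * b.
Proof.
by rewrite /ceil_val -divnDMl // mulnDr mulnCA [v * b * _]mulnC addnAC.
Qed.

Lemma leq_ceil_val (P v a b : nat) : a <= b -> ceil_val P v a <= ceil_val P v b.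
Proof. by move=> ab; rewrite leq_div2r // leq_add2r leq_mul2l ab orbT. Qed.

Lemma ceil_val_geq (P v a : nat) : v * a <= P.+1 * ceil_val P v a.
Proof.
rewrite /ceil_val; have := divn_eq (v * a + P) P.+1.
by have := @ltn_pmod (v * a + P) P.+1 isT; lia.
Qed.

Lemma ceil_val_exact (P v a : nat) :
  P.+1 %| v * a -> P.+1 * ceil_val P v a = v * a.
Proof.
case/dvdnP=> b E.
by rewrite /ceil_val E divnMDl // divn_small // addn0 mulnC.
Qed.

(** The divisibility makes the ceiling at [a] exact; otherwise both ceilings could coincide. Hence
    divisibility is carried along in the proof of equality. *)
Lemma ltn_ceil_val (P v a b : nat) : 0 < v -> P.+1 %| v * a -> a < b ->
  ceil_val P v a < ceil_val P v b.
Proof.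
move=> v0 ka ab; rewrite -(ltn_pmul2l (isT : 0 < P.+1)) ceil_val_exact //.
by apply: leq_trans (ceil_val_geq _ _ _); rewrite ltn_pmul2l.
Qed.

Lemma ceil_val0 (P v : nat) : ceil_val P v 0 = 0.
Proof. by rewrite /ceil_val muln0 add0n divn_small. Qed.

(** * Valuations from the recursion, for abstract counts *)

Section Recursion.

(** [e j] stands for the pairs whose vector has order exactly [j.+1], so its index is one below the
    chain length. [w j m] collects the factors prime to [p] in the number of free tuples. *)
Variables (p v P : nat) (d e : nat -> nat -> nat) (w : nat -> nat -> nat).
Hypotheses (p_pr : prime p) (v_gt0 : 0 < v) (P_gt0 : 0 < P).
Local Notation q := (p ^ v).
Hypothesis d_last : forall n, d P n = q ^ n * d 0 n.
Hypothesis d_rec : forall j n, j < P -> d j.+1 n = d j n + e j n.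
Hypothesis e_small : forall j n, n <= j -> e j n = 0.
Hypothesis e_rec : forall j m, j < P ->
  e j (j.+1 + m) = q ^ ('C(j.+1, 2) + j * m) * w j m * d (P - j.+1) m.
Hypothesis w_coprime : forall j m, coprime p (w j m).
Hypothesis d00 : d 0 0 = 1.
Hypothesis d01 : d 0 1 = 1.

Local Notation c j n := (ceil_val P v (weight P j n)).

(** [d_rec] telescopes from [j] up to [P], where [d_last] returns to index 0. *)
Lemma d_sum j n : j <= P -> q ^ n * d 0 n = d j n + \sum_(j <= l < P) e l n.
Proof.
rewrite -d_last => jP.
have E l : l <= P - j -> d (j + l) n = d j n + \sum_(j <= i < j + l) e i n.
  elim: l => [_|l IH lt]; first by rewrite addn0 big_geq // addn0.
  by rewrite addnS d_rec ?IH ?big_nat_recr ?addnA //=; lia.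
by have := E (P - j) (leqnn _); rewrite subnKC.
Qed.

Lemma dvdn_e j n : j < P ->
  (forall i m, m < n -> i <= P -> p ^ c i m %| d i m) -> p ^ c j n %| e j n.
Proof.
move=> jP IH; case: (leqP n j) => [nj|jn]; first by rewrite e_small ?dvdn0.
have {jn}[m En] : exists m, n = j.+1 + m by exists (n - j.+1); rewrite subnKC.
rewrite En e_rec // weight_step // ceil_valD addnC expnD -mulnA -expnM.
by rewrite dvdn_mul // dvdn_mull // IH ?leq_subr // En; lia.
Qed.

Lemma dvdn_sum_e j i n : i <= j ->
  (forall i m, m < n -> i <= P -> p ^ c i m %| d i m) ->
  p ^ c i n %| \sum_(j <= l < P) e l n.
Proof.
move=> ij IH; rewrite big_nat; apply: dvdn_sum => l /andP[jl lP].
apply: dvdn_trans (dvdn_e lP IH); apply/dvdn_exp2l/leq_ceil_val.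
by rewrite leq_add2l leq_mul2r (leq_trans ij jl) orbT.
Qed.

Lemma coprime_pred_q n : 0 < n -> coprime p (q ^ n).-1.
Proof.
move=> n0; rewrite -(@coprime_pexpl (v * n)) ?muln_gt0 ?v_gt0 // expnM.
by rewrite coprimenP // !expn_gt0 prime_gt0.
Qed.

Lemma d0_sum n : (q ^ n).-1 * d 0 n = \sum_(0 <= l < P) e l n.
Proof.
apply/eqP; rewrite -(eqn_add2l (d 0 n)) -d_sum // -mulSn prednK //.
by rewrite !expn_gt0 prime_gt0.
Qed.

(** Strong induction on [n], for all [j] at once: first [j = 0], by cancelling the unit [(q ^ n).-1]
    in [d0_sum], then any [j] by subtracting a tail sum from [q ^ n * d 0 n]. *)
Lemma dvdn_d j n : j <= P -> p ^ c j n %| d j n.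
Proof.
elim/ltn_ind: n j => n IHn j jP.
have IH i m : m < n -> i <= P -> p ^ c i m %| d i m by move=> /IHn; apply.
have [->|n0] := posnP n.
  by rewrite /weight bin0n !muln0 ceil_val0.
have H0 : p ^ c 0 n %| d 0 n.
  rewrite -(@Gauss_dvdr _ (q ^ n).-1) ?coprimeXl ?coprime_pred_q //.
  by rewrite d0_sum dvdn_sum_e.
(* Multiplication by [q ^ n] adds [P.+1 * n] to the weight, which covers [j * n] because
   [j <= P]. *)
have H1 : p ^ c j n %| q ^ n * d 0 n.
  apply: dvdn_trans (dvdn_mul (dvdnn _) H0).
  rewrite -expnM -expnD dvdn_exp2l // addnC -ceil_valD leq_ceil_val //.
  by rewrite /weight; nia.
by move: H1; rewrite (d_sum _ jP) dvdn_addl // dvdn_sum_e.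
Qed.

(** Exact valuation by divisibility alone, so that sums can be handled without positivity
    conditions. *)
Definition exactly x a := (p ^ a %| x) && ~~ (p ^ a.+1 %| x).

Lemma exactlyD x y a : p ^ a.+1 %| y -> exactly (x + y) a = exactly x a.
Proof.
move=> H; rewrite /exactly !dvdn_addl //.
by apply: dvdn_trans H; rewrite dvdn_exp2l.
Qed.

Lemma exactlyN x y a : p ^ a.+1 %| x + y -> exactly x a = exactly y a.
Proof.
move=> H; have D b : b <= a.+1 -> (p ^ b %| x) = (p ^ b %| y).
  move=> ba; have {}H : p ^ b %| x + y by apply: dvdn_trans H;
    rewrite dvdn_exp2l.
  by apply/idP/idP => ?; [rewrite -(dvdn_addr (m := x))|rewrite -(dvdn_addl (n
    := y))].
by rewrite /exactly !D.
Qed.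

Lemma exactlyM x y a : coprime p y -> exactly (y * x) a = exactly x a.
Proof. by move=> co; rewrite /exactly !Gauss_dvdr ?coprimeXl. Qed.

Lemma exactlyX x a b : exactly x a -> exactly (p ^ b * x) (a + b).
Proof.
have pb : 0 < p ^ b by rewrite expn_gt0 prime_gt0.
by rewrite /exactly -addSn !(addnC _ b) !expnD !dvdn_pmul2l.
Qed.

Lemma exactly_logn x a : 0 < x -> exactly x a -> logn p x = a.
Proof.
move=> x0 /andP[]; rewrite !pfactor_dvdn // => H1 H2.
by apply/eqP; rewrite eqn_leq H1 leqNgt H2.
Qed.

(** Exactness travels from [d 0 m] to [e P.-1 n], then to [d P.-1 n], to [e 0 n.+1] and to
    [d 0 n.+1], where [n = P + m]; at each stage the other terms have strictly larger bounds. *)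
Lemma exact_step m : P.+1 %| v * weight P 0 m -> exactly (d 0 m) (c 0 m) ->
  P.+1 %| v * weight P 0 (P.+1 + m) /\
  exactly (d 0 (P.+1 + m)) (c 0 (P.+1 + m)).
Proof.
move=> km Em; pose n := P + m.
have n0 : 0 < n by rewrite ltn_addr.
have W1 : weight P P.-1 n = weight P 0 m + P.+1 * ('C(P, 2) + P.-1 * m).
  by have := @weight_step P P.-1 m; rewrite prednK // subnn; apply.
have W0 : weight P 0 n.+1 = weight P P.-1 n.
  by rewrite -[n.+1]add1n weight_step // subn1 bin_small // !mul0n !muln0 addn0.
have kn : P.+1 %| v * weight P P.-1 n.
  by rewrite W1 mulnDr dvdn_addr // mulnCA dvdn_mulr.
split; first by rewrite addSn W0.
rewrite addSn W0.
have E1 : exactly (e P.-1 n) (c P.-1 n).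
  have := @e_rec P.-1 m; rewrite prednK // => -> //.
  rewrite subnn -mulnA -expnM W1 ceil_valD; apply: exactlyX.
  by rewrite exactlyM.
have E2 : exactly (d P.-1 n) (c P.-1 n).
  (* The sum of the two terms is [q ^ n * d 0 n], whose bound exceeds [weight P 0 n] by [P.+1 * n],
     whereas [weight P P.-1 n] exceeds it only by [P.-1 * n]. *)
  rewrite (@exactlyN _ (e P.-1 n)) // -d_rec ?prednK // d_last.
  have := dvdn_mul (dvdnn (q ^ n)) (dvdn_d n (leq0n P)).
  rewrite -expnM -expnD addnC -ceil_valD; apply: dvdn_trans.
  rewrite dvdn_exp2l // ltn_ceil_val // /weight mul0n addn0 ltn_add2l.
  by rewrite ltn_pmul2r // prednK // ltnW.
have E3 : e 0 n.+1 = w 0 n * d P.-1 n.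
  by rewrite -[n.+1]add1n e_rec // bin_small // mul1n subn1.
rewrite -(@exactlyM _ (q ^ n.+1).-1) ?coprime_pred_q // d0_sum big_ltn // E3.
rewrite exactlyD ?exactlyM //.
(* The terms after the first have weight at least [weight P 1 n.+1], hence higher valuation; for
   [P = 1] there are none. *)
case: (ltnP 1 P) => [P1|P1]; last by rewrite big_geq ?dvdn0.
apply: dvdn_trans (dvdn_sum_e (leqnn 1) _); last by move=> *; apply: dvdn_d.
by rewrite dvdn_exp2l // ltn_ceil_val // -W0 /weight ltn_add2l.
Qed.

Lemma exact_d n : n = 0 %[mod P.+1] \/ n = 1 %[mod P.+1] ->
  P.+1 %| v * weight P 0 n /\ exactly (d 0 n) (c 0 n).
Proof.
have H m s : m <= 1 -> P.+1 %| v * weight P 0 (s * P.+1 + m) /\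
    exactly (d 0 (s * P.+1 + m)) (c 0 (s * P.+1 + m)).
  move=> m1; elim: s => [|s [IH1 IH2]]; last first.
    by rewrite mulSn -addnA; apply: exact_step.
  have E : weight P 0 m = 0 by rewrite /weight bin_small // muln0.
  rewrite mul0n add0n E muln0 ceil_val0 dvdn0; split=> //.
  have -> : d 0 m = 1 by case: m m1 {E} => [|[]].
  by rewrite /exactly dvdn1 expn1 dvdn1; case: p p_pr => [|[]].
by case=> E; rewrite (divn_eq n P.+1) E modn_small ?ltnS //; apply: H.
Qed.

Lemma logn_bound n : 0 < d 0 n ->
  v * P.-1 * 'C(n, 2) <= P.+1 * logn p (d 0 n).
Proof.
move=> dn; have := dvdn_d n (leq0n P); rewrite pfactor_dvdn // => le.
apply: leq_trans (leq_mul (leqnn P.+1) le).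
by apply: leq_trans (ceil_val_geq _ _ _); rewrite /weight mul0n addn0 mulnA.
Qed.

Lemma logn_exact n : n = 0 %[mod P.+1] \/ n = 1 %[mod P.+1] ->
  0 < d 0 n -> P.+1 * logn p (d 0 n) = v * P.-1 * 'C(n, 2).
Proof.
move=> /exact_d[k En] dn; rewrite (exactly_logn dn En) ceil_val_exact //.
by rewrite /weight mul0n addn0 mulnA.
Qed.

End Recursion.

(** * Homomorphisms from a cyclic group, and counting tools *)

(** Evaluation at a generator is the bijection; its inverse extends [x] to [a] by [eltm], possible
    once the order of [a] divides that of [x]. *)
Lemma card_cyclic_homs (G H : finGroupType) : cyclic [set: G] ->
  #|group_homs G H| = #|[set a : H | (a ^+ #|G| == 1)%g]|.
Proof.
case/cyclicP=> x Gx; have ox : #[x]%g = #|G| by rewrite /order -Gx cardsT.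
have xG y : y \in <[x]>%g by rewrite -Gx inE.
have fX (f : {ffun G -> H}) i : f \in group_homs G H -> f (x ^+ i)%g =
  (f x ^+ i)%g.
  rewrite inE => /morphicP fM; elim: i => [|i IH].
    by apply: (mulgI (f 1%g)); rewrite -fM ?inE // !mulg1.
  by rewrite !expgS fM ?inE // IH.
rewrite -(card_in_imset (f := fun f : {ffun G -> H} => f x)) => [|f g fG gG fg].
  apply: eq_card => a; apply/imsetP/idP => [[f fG ->]|].
    by rewrite inE -fX // -ox expg_order -(expg0 x) fX.
  rewrite inE -ox -order_dvdn => dv; exists [ffun y => eltm dv y]; last first.
    by rewrite ffunE eltm_id.
  by rewrite inE; apply/morphicP=> y z _ _; rewrite !ffunE morphM.
apply/ffunP=> y; have /cycleP[i ->] := xG y.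
by rewrite !fX // fg.
Qed.

Local Open Scope ring_scope.

Lemma card_set_can (T1 T2 : finType) (f : T1 -> T2) (g : T2 -> T1)
    (A : {set T1}) (B : {set T2}) :
  {in A, cancel f g} -> {in B, cancel g f} ->
  {in A, forall x, f x \in B} -> {in B, forall y, g y \in A} -> #|A| = #|B|.
Proof.
move=> fK gK fAB gBA; rewrite -(card_in_imset (can_in_inj fK)).
apply: eq_card => y; apply/imsetP/idP => [[x xA ->]|yB]; first exact: fAB.
by exists (g y); rewrite ?gBA ?gK.
Qed.

Lemma card_set_sigma (T1 T2 : finType) (P : pred T1) (Q : T1 -> pred T2) :
  #|[set x : T1 * T2 | P x.1 && Q x.1 x.2]| =
    (\sum_(a | P a) #|[set b | Q a b]|)%N.
Proof.
transitivity (\sum_(a | P a) \sum_(b | Q a b) 1)%N.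
  by rewrite pair_big_dep sum1dep_card.
by apply: eq_bigr => a _; rewrite sum1dep_card.
Qed.

Lemma card_set_pair (T1 T2 : finType) (P : pred T1) (Q : T1 -> pred T2)
    (c : nat) :
  (forall a, P a -> #|[set b | Q a b]| = c) ->
  #|[set x : T1 * T2 | P x.1 && Q x.1 x.2]| = (#|[set a | P a]| * c)%N.
Proof.
by move=> cP; rewrite card_set_sigma (eq_bigr _ cP) cardsE sum_nat_const.
Qed.

(** * Counting tuples of independent rows *)

Section RowFree.
Variable F : finFieldType.
Implicit Types j n : nat.

Lemma row_free_col_mx j n (v : 'rV[F]_n) (A : 'M[F]_(j, n)) :
  row_free (col_mx v A) = row_free A && ~~ (v <= A)%MS.
Proof.
rewrite /row_free -addsmxE.
have [le1 _] := mxrank_adds_leqif v A.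
have [le2 eq2] := mxrank_leqif_sup (addsmxSr v A).
have rv := rank_leq_row v; have rA := rank_leq_row A.
rewrite addsmx_sub submx_refl andbT in eq2; rewrite -eq2.
by apply/idP/idP; lia.
Qed.

(** A new row placed on top of [j] independent ones has to avoid the [#|F| ^ j] vectors of their
    span. *)
Lemma card_row_free j n : (j <= n)%N ->
  #|[set A : 'M[F]_(j, n) | row_free A]| =
    (\prod_(i < j) (#|F| ^ n - #|F| ^ i))%N.
Proof.
elim: j => [_|j IH jn].
  rewrite big_ord0 (@eq_card1 _ (0 : 'M_(0, n))) // => A.
  by rewrite [A]flatmx0 !inE /row_free eqn_leq rank_leq_row eqxx.
rewrite big_ord_recr /= -IH ?(ltnW jn) //.
rewrite -(@card_set_pair _ _ (@row_free _ _ _)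
  (fun (A : 'M[F]_(j, n)) (v : 'rV_n) => ~~ (v <= A)%MS)).
  apply: (@card_set_can _ _ (fun A : 'M_(1 + j, n) => (dsubmx A, usubmx A))
    (fun x => col_mx x.2 x.1)) => [A _|[A v] _|A|[A v]] /=.
  - by rewrite vsubmxK.
  - by rewrite col_mxKu col_mxKd.
  - by rewrite !inE /= -row_free_col_mx vsubmxK.
  - by rewrite !inE /= -row_free_col_mx.
move=> A /eqP rA; have -> : [set v | ~~ (v <= A)%MS] = ~: rowg A.
  by apply/setP=> v; rewrite !inE.
by rewrite cardsCs setCK card_rowg rA card_mx mul1n.
Qed.

Lemma card_row_free_factor j n : (j <= n)%N ->
  #|[set A : 'M[F]_(j, n) | row_free A]| =
    (#|F| ^ 'C(j, 2) * \prod_(i < j) (#|F| ^ (n - i) - 1))%N.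
Proof.
move=> jn; rewrite card_row_free // -bin2_sum big_mkord expn_sum -big_split /=.
apply: eq_bigr => i _; rewrite mulnBr muln1 -expnD subnKC //.
by rewrite ltnW // (leq_trans (ltn_ord i)).
Qed.

(** * Krylov matrices and the shift *)

Definition krylov j n (T : 'M[F]_n) (v : 'rV_n) : 'M[F]_(j, n) :=
  \matrix_(i, l) (v *m T ^+ i) ord0 l.

Definition shift_mx j : 'M[F]_j := \matrix_(i, l) (l == i.+1 :> nat)%:R.

Lemma row_krylov j n T v (i : 'I_j) : row i (@krylov j n T v) = v *m T ^+ i.
Proof. by apply/rowP=> l; rewrite !mxE. Qed.

Lemma row_shift_mul j n (K : 'M[F]_(j, n)) (i : 'I_j) :
  row i (shift_mx j *m K) = oapp (fun l => row l K) 0 (insub i.+1).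
Proof.
rewrite row_mul; case: insubP => [l lj li|] /=.
  by rewrite [RHS]rowE; congr (_ *m _); apply/rowP=> a;
    rewrite !mxE eqxx /= -li.
move=> ij; rewrite (_ : row i _ = 0) ?mul0mx //; apply/rowP=> a.
by rewrite !mxE; case: eqP => // E; rewrite -E ltn_ord in ij.
Qed.

Lemma mulmx_exprS n (v : 'rV[F]_n) (T : 'M_n) i : v *m T ^+ i.+1 =
  v *m T ^+ i *m T.
Proof. by rewrite exprSr -mulmxA. Qed.

Lemma mulmx_exprD n m (v : 'M[F]_(m, n)) (T : 'M_n) i k : v *m T ^+ (i + k) =
  v *m T ^+ i *m T ^+ k.
Proof. by rewrite exprD -mulmxA. Qed.

Lemma krylov_shift j n (T : 'M[F]_n) v : v *m T ^+ j = 0 ->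
  krylov j T v *m T = shift_mx j *m krylov j T v.
Proof.
move=> vT; apply/row_matrixP=> i; rewrite row_shift_mul row_mul row_krylov.
rewrite -mulmx_exprS; case: insubP => [l _ <-|] /=; first by rewrite row_krylov.
by rewrite -ltnNge ltnS => ij; rewrite (_ : i.+1 = j) ?vT //; apply/eqP;
  rewrite eqn_leq ltn_ord.
Qed.

Lemma krylov_row_free j n (T : 'M[F]_n) v :
  v *m T ^+ j.+1 = 0 -> v *m T ^+ j != 0 -> row_free (krylov j.+1 T v).
Proof.
move=> vT vT0; apply: inj_row_free => u uK.
have H k : forall i : 'I_j.+1, (i < k)%N -> u 0 i = 0.
  elim: k => // k IH i; rewrite ltnS leq_eqVlt => /predU1P[ik|]; last exact: IH.
  (* Multiplying by [T ^+ (j - k)] turns the term [k] into a multiple of [v *m T ^+ j] and kills all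
     later terms; the earlier coefficients vanish by induction. *)
  have := congr1 (mulmx^~ (T ^+ (j - k))) uK.
  rewrite (mulmx_sum_row u) mulmx_suml mul0mx (bigD1 i) //= big1 => [|l li].
    rewrite addr0 -scalemxAl row_krylov -mulmx_exprD ik subnKC -?ik ?leq_ord //.
    by move/eqP; rewrite scalemx_eq0 (negPf vT0) orbF => /eqP.
  case: (ltnP l k) => [/IH->|kl]; first by rewrite scale0r mul0mx.
  rewrite -scalemxAl row_krylov -mulmx_exprD.
  have -> : (l + (j - k) = j.+1 + (l - k.+1))%N.
    have : (l != k :> nat) by rewrite -ik.
    have := leq_ord i; lia.
  by rewrite mulmx_exprD vT mul0mx scaler0.
by apply/rowP=> i; rewrite mxE (H j.+1).
Qed.

(** The intertwining relation says that [T] sends each row of [K] to the next, so the first row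
    determines [K]. *)
Lemma krylov_row0 j n (K : 'M[F]_(j.+1, n)) T :
  K *m T = shift_mx j.+1 *m K -> krylov j.+1 T (row 0 K) = K.
Proof.
move=> KT; have H k : (k < j.+1)%N -> row 0 K *m T ^+ k = row (inord k) K.
  elim: k => [|k IH] kj; first by rewrite expr0 mulmx1; congr row;
    apply/val_inj; rewrite /= inordK.
  rewrite mulmx_exprS IH 1?ltnW // -row_mul KT row_shift_mul inordK
    ?(ltnW kj) //.
  rewrite insubT /=; congr row; apply/val_inj; rewrite /= inordK //.
apply/row_matrixP=> i; rewrite row_krylov H // inord_val //.
Qed.

Lemma krylov_shift_last j n (K : 'M[F]_(j.+1, n)) T :
  K *m T = shift_mx j.+1 *m K -> row 0 K *m T ^+ j.+1 = 0.
Proof.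
move=> KT; have := krylov_row0 KT => /(congr1 (row ord_max)).
rewrite row_krylov mulmx_exprS => ->; rewrite -row_mul KT row_shift_mul.
by rewrite insubF //= ltnn.
Qed.

(** * Pairs of a nilpotent matrix and a vector *)

Definition nil_pairs P j n :=
  [set x : 'M[F]_n * 'rV[F]_n | (x.1 ^+ P == 0) && (x.2 *m x.1 ^+ j == 0)].

Definition exact_pairs P j n :=
  [set x : 'M[F]_n * 'rV[F]_n |
    [&& x.1 ^+ P == 0, x.2 *m x.1 ^+ j.+1 == 0 & x.2 *m x.1 ^+ j != 0]].

Definition shift_fiber P j n (K : 'M[F]_(j, n)) :=
  [set T : 'M[F]_n | (T ^+ P == 0) && (K *m T == shift_mx j *m K)].

Lemma card_nil_pairsS P j n :
  #|nil_pairs P j.+1 n| = (#|nil_pairs P j n| + #|exact_pairs P j n|)%N.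
Proof.
rewrite -(cardsID (nil_pairs P j n) (nil_pairs P j.+1 n)).
congr (_ + _)%N; apply: eq_card => -[T v]; rewrite !inE /= -?mulmx_exprS.
  case: (T ^+ P == 0) => //=; rewrite andbC andb_idr // mulmx_exprS => /eqP->.
  by rewrite mul0mx.
by case: (T ^+ P == 0) => //=; rewrite andbC.
Qed.

Lemma card_exact_pairs0 P j n : (n <= j)%N -> #|exact_pairs P j n| = 0%N.
Proof.
move=> nj; apply: eq_card0 => -[T v]; rewrite !inE /=.
apply/negP=> /and3P[_ /eqP H1 /(krylov_row_free H1)].
by rewrite /row_free => /eqP rk; have := rank_leq_col (krylov j.+1 T v);
  rewrite rk ltnNge nj.
Qed.

(** Replacing the vector by its Krylov matrix is a bijection onto pairs of a free [K] and a [T] in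
    its fiber; the inverse takes the first row of [K]. *)
Lemma card_exact_pairs P j n c :
  (forall K : 'M[F]_(j.+1, n), row_free K -> #|shift_fiber P K| = c) ->
  #|exact_pairs P j n| = (#|[set A : 'M[F]_(j.+1, n) | row_free A]| * c)%N.
Proof.
move=> Hc; rewrite -(card_set_pair Hc).
apply: (@card_set_can _ _ (fun x => (krylov j.+1 x.1 x.2, x.1))
  (fun y => (y.2, row 0 y.1))) => [[T v] _|[K T]|[T v]|[K T]] /=.
- by rewrite row_krylov expr0 mulmx1.
- by rewrite !inE /= => /and3P[_ _ /eqP/krylov_row0->].
- rewrite !inE /= => /and3P[-> /eqP H1 H2].
  by rewrite krylov_row_free ?krylov_shift ?eqxx.
rewrite !inE /= => /and3P[rK -> /eqP KT]; rewrite (krylov_shift_last KT) eqxx /=.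
have <- : row ord_max K = row 0 K *m T ^+ j.
  by rewrite -{1}(krylov_row0 KT) row_krylov.
(* [v *m T ^+ j] is the last row of [K], which freeness prevents from being zero. *)
apply/eqP=> H; have := row_free_inj rK (x1 := delta_mx 0 ord_max : 'rV_j.+1)
  (x2 := 0).
rewrite /= -rowE H mul0mx => /(_ erefl)/matrixP/(_ 0 ord_max)/eqP.
by rewrite !mxE !eqxx oner_eq0.
Qed.

Lemma trmx_exp n (T : 'M[F]_n) k : (T ^+ k)^T = T^T ^+ k.
Proof. by elim: k => [|k IH]; rewrite ?trmx1 // exprSr trmx_mul IH exprS. Qed.

(** Needed because the corner condition constrains a column, while [nil_pairs] uses rows. *)
Lemma card_nil_pairs_tr P j n :
  #|[set x : 'M[F]_n * 'cV[F]_n | (x.1 ^+ P == 0) && (x.1 ^+ j *m x.2 == 0)]|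
  = #|nil_pairs P j n|.
Proof.
apply: (@card_set_can _ _ (fun x => (x.1^T, x.2^T)) (fun x => (x.1^T, x.2^T)))
  => [[T v] _|[T v] _|[T v]|[T v]] /=; rewrite ?trmxK // !inE /=.
  by move=> /andP[/eqP TP /eqP Tv]; rewrite -!trmx_exp -trmx_mul TP Tv !trmx0
    !eqxx.
by move=> /andP[/eqP TP /eqP Tv]; rewrite -!trmx_exp -trmx_mul TP Tv !trmx0
  !eqxx.
Qed.

(** * Reduction to a standard free matrix by conjugation *)

Definition unit_conj n (g T : 'M[F]_n) := g *m T *m invmx g.

Lemma unit_conjX n (g T : 'M[F]_n) k : g \in unitmx ->
  unit_conj g T ^+ k = unit_conj g (T ^+ k).
Proof.
move=> ug; elim: k => [|k IH]; first by rewrite /unit_conj mulmx1 mulmxV.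
by rewrite !exprS IH /unit_conj -!mulmxE !mulmxA mulmxKV.
Qed.

Lemma shift_fiber_conj P j n (K : 'M[F]_(j, n)) g : g \in unitmx ->
  #|shift_fiber P (K *m g)| = #|shift_fiber P K|.
Proof.
move=> ug; have ug' : invmx g \in unitmx by rewrite unitmx_inv.
apply: (@card_set_can _ _ (unit_conj g) (unit_conj (invmx g)))
  => [T _|T _|T|T]; rewrite /unit_conj ?invmxK ?mulmxA ?mulVmx ?mulmxV ?mulmxK
    ?mulmxKV ?mul1mx //.
- rewrite !inE => /andP[/eqP TP /eqP KT].
  by rewrite unit_conjX // TP /unit_conj mulmx0 mul0mx !mulmxA KT !mulmxA
    mulmxK // !eqxx.
rewrite !inE => /andP[/eqP TP /eqP KT].
have := unit_conjX T P ug'; rewrite /unit_conj invmxK => ->.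
by rewrite TP mulmx0 mul0mx !mulmxA mulmxK // KT !eqxx.
Qed.

Lemma row_free_pid_mx j m (K : 'M[F]_(j, j + m)) : row_free K ->
  exists2 g, g \in unitmx & K = row_mx 1%:M 0 *m g.
Proof.
(* In the rank factorization of [K] the middle factor is [row_mx 1%:M 0]; the left factor moves
   across it as a diagonal block. *)
move=> /eqP rK; exists (block_mx (col_ebase K) 0 0 1%:M *m row_ebase K).
  rewrite unitmx_mul row_ebase_unit andbT unitmxE det_ublock det1 mulr1.
  by rewrite -unitmxE col_ebase_unit.
rewrite mulmxA mul_row_block !mul0mx !mul1mx !addr0 -{1}(mulmx_ebase K) rK.
by rewrite pid_mx_row mul_mx_row mulmx1 mulmx0.
Qed.

(** * Powers of block triangular matrices and their corners *)

(** In closed form, the sum of [D ^+ i *m C *m J ^+ (k - 1 - i)] over [i < k]. *)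
Fixpoint corner j m (J : 'M[F]_j) (C : 'M_(m, j)) (D : 'M_m) k : 'M_(m, j) :=
  if k is k'.+1 then corner J C D k' *m J + D ^+ k' *m C else 0.

Lemma block_lower_expr j m (J : 'M[F]_j) (C : 'M_(m, j)) (D : 'M_m) k :
  block_mx J 0 C D ^+ k = block_mx (J ^+ k) 0 (corner J C D k) (D ^+ k).
Proof.
elim: k => [|k IH]; first by rewrite !expr0 -scalar_mx_block.
by rewrite exprSr IH [LHS]mulmx_block !mulmx0 !mul0mx !addr0 !add0r !mulmxE
  -!exprSr.
Qed.

Lemma col_shift_mul0 j m (C : 'M[F]_(m, j.+1)) : col ord0 (C *m shift_mx j.+1)
  = 0.
Proof. by apply/colP=> a; rewrite !mxE big1 // => i _; rewrite !mxE mulr0. Qed.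

Lemma col_shift_mulS j m (C : 'M[F]_(m, j.+1)) l : (l < j)%N ->
  col (inord l.+1) (C *m shift_mx j.+1) = col (inord l) C.
Proof.
move=> lj; apply/colP=> a; rewrite !mxE.
rewrite (bigD1 (inord l)) //= big1 => [|i il].
  by rewrite !mxE !inordK ?eqxx ?mulr1 ?addr0 // ltnW.
rewrite !mxE /= inordK // eqSS; case: eqP => [E|]; last by rewrite mulr0.
by case/eqP: il; apply/val_inj; rewrite /= -E inordK // ltnW.
Qed.

(* The condition that the l-th column of [corner] vanishes is, by this formula,
   implied by the condition for the last column. *)
Lemma col_corner j m (C : 'M[F]_(m, j.+1)) (D : 'M_m) k l : (l <= j)%N -> (l <
  k)%N ->
  col (inord l) (corner (shift_mx j.+1) C D k) =
  D ^+ (k - l.+1) *m \sum_(i < l.+1) D ^+ i *m col (inord i) C.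
Proof.
elim: k l => // k IH l lj lk /=; rewrite raddfD /= subSS [col _ (D ^+ k *m
  C)]colE -mulmxA -colE.
case: l lj lk => [|l] lj lk.
  rewrite (_ : inord 0 = ord0) ?col_shift_mul0 ?add0r; last by apply/val_inj;
    rewrite /= inordK.
  rewrite big_ord1 expr0 mul1mx subn0 (_ : inord 0 = ord0) //.
  by apply/val_inj; rewrite /= inordK.
rewrite col_shift_mulS // IH ?(ltnW lj) // [in RHS]big_ord_recr /= mulmxDr;
  congr (_ + _).
by rewrite mulmxA mulmxE -exprD subnK // ltnW.
Qed.

Lemma shift_mx_nil j k : (j <= k)%N -> shift_mx j ^+ k = 0.
Proof.
case: j => [|j] jk; first by rewrite [LHS]flatmx0 [RHS]flatmx0.
rewrite -(subnKC jk) exprD (_ : _ ^+ j.+1 = 0) ?mul0r //.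
(* The identity commutes with the shift, hence is the Krylov matrix of its own first row, and the
   facts on such matrices apply. *)
have E : 1%:M *m shift_mx j.+1 = shift_mx j.+1 *m 1%:M by rewrite mulmx1 mul1mx.
apply/row_matrixP=> i; rewrite row0.
have := congr1 (row i) (krylov_row0 E); rewrite row_krylov => H.
rewrite -[X in row i X]mul1mx row_mul -H -mulmxA mulmxE -exprD addnC exprD.
by rewrite -mulmxE mulmxA (krylov_shift_last E) mul0mx.
Qed.

Lemma corner_eq0 j m (C : 'M[F]_(m, j.+1)) (D : 'M_m) P : (j < P)%N -> D ^+ P
  = 0 ->
  (corner (shift_mx j.+1) C D P == 0) =
  (D ^+ (P - j.+1) *m \sum_(i < j.+1) D ^+ i *m col (inord i) C == 0).
Proof.
move=> jP DP; rewrite -col_corner //; apply/eqP/eqP => [->|H].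
  by apply/colP=> a; rewrite !mxE.
apply/matrixP=> a b; rewrite [RHS]mxE.
suff /colP/(_ a): col b (corner (shift_mx j.+1) C D P) = 0 by rewrite !mxE.
rewrite col_corner // in H.
rewrite -(inord_val b) col_corner ?leq_ord ?(leq_trans (ltn_ord b)) //.
(* This raises the exponent in the last-column condition to [P - b.+1]; the terms with [i > b] then
   contain [D ^+ P = 0], and the rest is column [b]. *)
have := congr1 (mulmx (D ^+ (j - b))) H; rewrite mulmx0 mulmxA mulmxE -exprD.
have -> : (j - b + (P - j.+1) = P - b.+1)%N by have := leq_ord b; lia.
rewrite -(big_mkord xpredT (fun i => D ^+ i *m col (inord i) C)).
rewrite (big_cat_nat (n := b.+1)) //= big_mkord mulmxDr.
rewrite [X in _ + X](_ : _ = 0) ?addr0 // mulmx_sumr big_nat big1 // =>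
  i /andP[bi _].
rewrite mulmxA mulmxE -exprD (_ : _ + _ = P + (i - b.+1))%N ?exprD ?DP ?mul0r
  ?mul0mx //.
by have := ltn_ord b; lia.
Qed.

(** Column 0 enters the sum with coefficient 1, so the sum itself can replace it as a coordinate,
    and the other [j] columns remain free. *)
Lemma card_corner j m (D : 'M[F]_m) k :
  #|[set C : 'M[F]_(m, j.+1) | D ^+ k *m \sum_(i < j.+1) D ^+ i *m col (inord
    i) C == 0]|
  = (#|[set w : 'cV[F]_m | (D ^+ k *m w == 0)%R]| * #|F| ^ (j * m))%N.
Proof.
pose f (C : 'M[F]_(m, 1 + j)) := \sum_(1 <= i < j.+1) D ^+ i *m col (inord i) C.
have fE C : \sum_(i < j.+1) D ^+ i *m col (inord i) C =
  lsubmx (C : 'M_(m, 1 + j)) + f C.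
  rewrite -(big_mkord xpredT (fun i => D ^+ i *m col (inord i) C)) big_ltn //
    expr0 mul1mx.
  congr (_ + _); apply/colP=> a; rewrite !mxE; congr (C _ _).
  by apply/val_inj; rewrite /= inordK // ord1.
have fr (w : 'cV_m) B : f (row_mx w B) = f (row_mx 0 B).
  rewrite /f !big_nat; apply: eq_bigr => i /andP[i1 ij]; congr (_ *m _).
  apply/colP=> a; rewrite !mxE; case: splitP => b; rewrite inordK //.
  by rewrite ord1 => E; rewrite E in i1.
rewrite -[(j * m)%N]mulnC -card_mx -cardsT.
rewrite -(@card_set_pair _ _ (fun w : 'cV_m => D ^+ k *m w == 0)
  (fun _ (_ : 'M[F]_(m, j)) => true)) => [|a _]; last first.
  by apply: eq_card => x; rewrite !inE.
apply: (@card_set_can _ _ (fun C : 'M[F]_(m, 1 + j) =>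
  (lsubmx C + f C, rsubmx C))
  (fun x => row_mx (x.1 - f (row_mx 0 x.2)) x.2)) => [C _|[w B] _|C|[w B]] /=.
- by rewrite -(fr (lsubmx C)) hsubmxK addrK hsubmxK.
- by rewrite row_mxKl row_mxKr (fr (w - _)) subrK.
- by rewrite !inE /= fE andbT.
by rewrite !inE /= andbT fE row_mxKl (fr (w - _)) subrK.
Qed.

Lemma block_shift_fiber P j m (A : 'M[F]_j) B (C : 'M_(m, j)) D : (j <= P)%N ->
  (block_mx A B C D \in shift_fiber P (row_mx 1%:M 0)) =
  [&& A == shift_mx j, B == 0, D ^+ P == 0 & corner (shift_mx j) C D P == 0].
Proof.
move=> jP; rewrite inE mul_row_block mul_mx_row !mul0mx !mul1mx !addr0 mulmx0
  mulmx1.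
apply/andP/and4P => [[/eqP TP /eqP/eq_row_mx[AJ B0]]|[/eqP-> /eqP-> /eqP DP
  /eqP C0]].
  move: TP; rewrite AJ B0 block_lower_expr -[X in _ = X]block_mx0.
  by case/eq_block_mx => _ _ -> ->; rewrite !eqxx.
by rewrite block_lower_expr DP C0 shift_mx_nil // block_mx0 !eqxx.
Qed.

(** After conjugation [T] is block lower triangular with a shift block. For each [D], the admissible
    corners number [#|F| ^ (j * m)] times the columns killed by [D ^+ (P - j.+1)]; summing over [D]
    gives the pairs. *)
Lemma card_shift_fiber P j m (K : 'M[F]_(j.+1, j.+1 + m)) : (j < P)%N ->
  row_free K ->
  #|shift_fiber P K| = (#|F| ^ (j * m) * #|nil_pairs P (P - j.+1) m|)%N.
Proof.
move=> jP /row_free_pid_mx[g ug ->]; rewrite shift_fiber_conj //.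
transitivity #|[set x : 'M[F]_m * 'M[F]_(m, j.+1) | (x.1 ^+ P == 0) &&
   (corner (shift_mx j.+1) x.2 x.1 P == 0)]|.
  symmetry; apply: (@card_set_can _ _
    (fun x => block_mx (shift_mx j.+1) 0 x.2 x.1 : 'M_(j.+1 + m))
    (fun T => (drsubmx T, dlsubmx T))).
  - by case=> D C _; rewrite block_mxKdr block_mxKdl.
  - move=> T; rewrite -{1}(submxK T) block_shift_fiber // =>
    /and4P[/eqP H1 /eqP H2 _ _].
    by rewrite -[RHS]submxK H1 H2.
  - by case=> D C; rewrite block_shift_fiber // inE !eqxx.
  by move=> T; rewrite -{1}(submxK T) block_shift_fiber // inE /= =>
    /and4P[_ _ -> ->].
rewrite mulnC -card_nil_pairs_tr.
have E1 := card_set_sigma (fun D : 'M[F]_m => D ^+ P == 0)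
  (fun D C => corner (shift_mx j.+1) C D P == 0).
have E2 := card_set_sigma (fun D : 'M[F]_m => D ^+ P == 0)
  (fun D (w : 'cV_m) => D ^+ (P - j.+1) *m w == 0).
rewrite /= in E1 E2; rewrite {}E1 {}E2 big_distrl /=;
  apply: eq_bigr => D /eqP DP.
rewrite -card_corner; apply: eq_card => C; rewrite !inE corner_eq0 //.
Qed.

End RowFree.

(** * From roots of unity in the general linear group to nilpotent matrices *)

Lemma gl_mxX n (F : finFieldType) (A : gl n F) k : gl_mx (A ^+ k)%g =
  gl_mx A ^+ k.
Proof. by elim: k => // k IH; rewrite expgS exprS -IH. Qed.

Lemma expr_add1_pchar n (F : finFieldType) p u (T : 'M[F]_n) : p \in [pchar F]
  ->
  (1 + T) ^+ (p ^ u) = 1 + T ^+ (p ^ u).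
Proof.
(* The zero ring of empty matrices is treated apart from the Frobenius argument. *)
case: n T => [|n] T Fp; first by rewrite [LHS]flatmx0 [RHS]flatmx0.
have Mp : p \in [pchar 'M[F]_n.+1] by rewrite pchar_lalg.
elim: u => [|u IH]; first by rewrite expn0 !expr1.
rewrite expnSr !exprM IH -!(pFrobenius_autE Mp) pFrobenius_autD_comm
  ?pFrobenius_aut1 //.
exact/commr_sym/commr1.
Qed.

Lemma card_gl_roots n (F : finFieldType) p u : prime p -> p \in [pchar F] ->
  #|[set A : gl n F | (A ^+ (p ^ u) == 1)%g]| = #|nil_pairs F (p ^ u) 0 n|.
Proof.
(* The vector is 0 because index 0 imposes [v *m T ^+ 0 = 0]. *)
move=> p_pr Fp; pose f (A : gl n F) : 'M[F]_n * 'rV[F]_n := (gl_mx A - 1, 0).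
have f_inj : injective f by move=> A B [/addIr AB]; apply: val_inj.
have root1 (A : gl n F) : (A ^+ (p ^ u) == 1)%g =
  ((gl_mx A - 1) ^+ (p ^ u) == 0).
  rewrite -(inj_eq val_inj) /= gl_mxX.
  have := expr_add1_pchar u (gl_mx A - 1) Fp; rewrite addrC subrK => ->.
  by rewrite -[RHS](inj_eq (addrI 1)) addr0.
rewrite -(card_imset _ f_inj); apply: eq_card => -[T v].
rewrite inE /= expr0 mulmx1; apply/imsetP/andP => [[A]|[TP /eqP->]].
  by rewrite inE root1 => AP [-> ->].
(* As [(1 + T) ^+ (p ^ u) = 1], the preceding power is an inverse of [1 + T]. *)
have [//|uT _] := @mulmx1_unit _ _ (1 + T) ((1 + T) ^+ (p ^ u).-1).
  by rewrite mulmxE -exprS prednK ?expn_gt0 ?prime_gt0 // expr_add1_pchar //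
    (eqP TP) addr0.
by exists (GL uT); rewrite /f /= ?inE ?root1 /= addrC addKr.
Qed.

(** For index [P] the vector is arbitrary, for index 0 it is zero. *)
Lemma card_nil_pairs_last n (F : finFieldType) P :
  #|nil_pairs F P P n| = (#|F| ^ n * #|nil_pairs F P 0 n|)%N.
Proof.
have E (Z : {set 'rV[F]_n}) (D : pred 'M[F]_n) :
  #|[set x : 'M[F]_n * 'rV[F]_n | D x.1 && (x.2 \in Z)]| =
    (#|[set T | D T]| * #|Z|)%N.
  by apply: (card_set_pair (Q := fun _ v => v \in Z)) => T _;
    apply: eq_card => v; rewrite inE.
have := E [set 0] (fun T => T ^+ P == 0); have := E [set: 'rV[F]_n] (fun T =>
  T ^+ P == 0).
rewrite cards1 muln1 cardsT card_mx mul1n mulnC => E1 E2.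
transitivity (#|F| ^ n * #|[set T : 'M[F]_n | (T ^+ P == 0)%R]|)%N.
  rewrite -E1; apply: eq_card => -[T v]; rewrite !inE /= andbT andb_idr // =>
    /eqP->.
  by rewrite mulmx0.
by rewrite -E2; congr (_ * _)%N; apply: eq_card => -[T v];
  rewrite !inE /= expr0 mulmx1.
Qed.

Lemma card_nil_pairs_small n (F : finFieldType) P : (n <= 1)%N -> (0 < P)%N ->
  #|nil_pairs F P 0 n| = 1%N.
Proof.
move=> n1 P0; rewrite (@eq_card1 _ (0, 0)) // => -[T v];
  rewrite !inE /= expr0 mulmx1 xpair_eqE.
congr (_ && _); case: n n1 T {v} => [|[|]] // _ T.
  by rewrite [T]flatmx0 [_ ^+ P]flatmx0.
apply/eqP/eqP => [|->]; last by rewrite -(prednK P0) exprS mul0r.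
rewrite [T]mx11_scalar -rmorphXn => /matrixP/(_ 0 0)/eqP;
  rewrite !mxE eqxx mulr1n.
by rewrite expf_eq0 => /andP[_ /eqP->]; rewrite raddf0.
Qed.

(** * The recursion applied to the actual counts *)

Theorem theorem3p4 (p u v n : nat) (C : finGroupType) (F : finFieldType)
    (p_prime : prime p) (v_ge1 : (1 <= v)%N)
    (C_cyclic : cyclic [set: C]) (card_C : #|C| = (p ^ u)%N)
    (card_F : #|F| = (p ^ v)%N) :
  let vp : rat := ((logn p #|group_homs C (gl n F)|)%:R)%R in
  let bound : rat :=
    (v%:R * ((p%:R ^+ u - 1) / (p%:R ^+ u + 1)) * 'C(n, 2)%:R)%R in
  (bound <= vp)%R /\
  (n = 0 %[mod (p ^ u).+1] \/ n = 1 %[mod (p ^ u).+1] -> vp = bound).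
Proof.
move=> vp bound; pose P := (p ^ u)%N.
have P0 : (0 < P)%N by rewrite expn_gt0 prime_gt0.
pose d j m := #|nil_pairs F P j m|.
have dE : #|group_homs C (gl n F)| = d 0%N n.
  by rewrite card_cyclic_homs // card_C card_gl_roots ?(card_finPcharP card_F).
have d0 : (0 < d 0 n)%N.
  apply/card_gt0P; exists (0, 0); rewrite inE /= mul0mx eqxx andbT.
  by rewrite -(prednK P0) exprS mul0r.
pose w j m := (\prod_(i < j.+1) ((p ^ v) ^ (j.+1 + m - i) - 1))%N.
have d_last m : d P m = ((p ^ v) ^ m * d 0 m)%N by
  rewrite -card_F -card_nil_pairs_last.
have d_rec j m : (j < P)%N -> d j.+1 m = (d j m + #|exact_pairs F P j m|)%N.
  by move=> _; apply: card_nil_pairsS.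
have e_small j m : (m <= j)%N -> #|exact_pairs F P j m| =
  0%N by apply: card_exact_pairs0.
have e_rec j m : (j < P)%N -> #|exact_pairs F P j (j.+1 + m)| =
    ((p ^ v) ^ ('C(j.+1, 2) + j * m) * w j m * d (P - j.+1)%N m)%N.
  move=> jP; rewrite (card_exact_pairs (fun K => @card_shift_fiber _ _ _ _ K
    jP)).
  by rewrite card_row_free_factor ?leq_addr // /w card_F expnD -!mulnA;
    congr (_ * _)%N; rewrite mulnCA.
have wco j m : coprime p (w j m).
  rewrite /w; elim/big_rec: _ => [|i x _ co]; first by rewrite coprimen1.
  rewrite coprimeMr co andbT subn1 coprime_pred_q // subn_gt0.
  by rewrite (leq_trans (ltn_ord i)) ?leq_addr.
have d00 : d 0 0 = 1%N by apply: card_nil_pairs_small.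
have d01 : d 0 1 = 1%N by apply: card_nil_pairs_small.
have q0 : 0 < (p%:R ^+ u + 1 : rat).
  by rewrite ltr_wpDl ?ltr01 // exprn_ge0 // ler0n.
(* Clearing the denominator [P.+1] turns both claims into statements on natural numbers. *)
have bE : bound * P.+1%:R = (v * P.-1 * 'C(n, 2))%:R.
  rewrite /bound !natrM -subn1 natrB // -(addn1 P) natrD /P natrX.
  by rewrite mulrAC -[_ * _ * (_ + 1)]mulrA divfK // gt_eqF.
have k0 : 0 < P.+1%:R :> rat by rewrite ltr0n.
split=> [|nP].
  rewrite -(ler_pM2r k0) bE -natrM ler_nat dE [leqRHS]mulnC.
  by apply: (logn_bound p_prime v_ge1 P0 d_last d_rec e_small e_rec).
apply: (mulIf (lt0r_neq0 k0)); apply/eqP; rewrite bE /vp dE -natrM eqr_nat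
  mulnC; apply/eqP.
by apply: (logn_exact p_prime v_ge1 P0 d_last d_rec e_small e_rec).
Qed.
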